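(* Let $E$ be a unital truncated Riesz space, and let $E\oplus\mathbb{R}$ be its Alexandroff unitization. Then $E\oplus\mathbb{R}$ is Archimedean if and only if $E$ is Archimedean.
   Context: A truncation on a (real) Riesz space $E$ is a map $x\mapsto\bar{x}$ from $E^{+}$ to $E^{+}$ such that for all $a,b\in E^{+}$: $(\tau_1)$ $a\wedge\bar{b}\leq\bar{a}\leq a$; $(\tau_2)$ $\bar{a}=0$ implies $a=0$. A truncated Riesz space is a Riesz space $E$ equipped with a truncation. It is called unital if there exists $u\in E^{+}$ (the truncation unit) such that $\bar{x}=x\wedge u$ for all $x\in E^{+}$. The set of fixed points is $\bar{E}=\{x\in E:\overline{|x|}=|x|\}$. The (Alexandroff) unitization $E\oplus\mathbb{R}=\{x+\lambda: x\in E,\lambda\in\mathbb{R}\}$ is the vector space $E\times\mathbb{R}$ (with $E$ identified with $E\times\{0\}$ and $\mathbb{R}$ with $\{0\}\times\mathbb{R}$, so $1=(0,1)$), ordered by the positive cone $(E\oplus\mathbb{R})^{+}=E^{+}\cup\{x+\lambda: x\in E,\ \lambda\in\mathbb{R},\ \lambda>0,\ \tfrac{1}{\lambda}x^{-}\in\bar{E}\}$. It is known that $E\oplus\mathbb{R}$ is a Riesz space, that $E$ is a vector sublattice (indeed a maximal ideal) of it, and that $\bar{x}=x\wedge 1$ for all $x\in E^{+}$. This space is used whether or not $E$ is unital. *)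

(* Defs.v *)
From HB Require Import structures.
From mathcomp Require Import all_boot all_order all_algebra reals.

Set Implicit Arguments.
Unset Strict Implicit.
Unset Printing Implicit Defensive.

Import Order.TTheory GRing.Theory Num.Theory.
Local Open Scope ring_scope.

(* The lattice operations are fields of their own, with the universal properties
   of [Order.Lattice]: HB rejects a structure joining lattices and modules
   because [Num.RealDomain] already inherits from both lattices and Z-modules. *)
HB.mixin Record POrderedLmodule_isRiesz (R : realType) E
    of GRing.Lmodule R E & Num.POrderedZmodule E := {
  riesz_leD2r : forall z x y : E, x <= y -> x + z <= y + z ;
  riesz_scale_ge0 : forall (a : R) (x : E), 0 <= a -> 0 <= x -> 0 <= a *: x ;
  riesz_meet : E -> E -> E ;
  riesz_join : E -> E -> E ;
  riesz_meetP : forall x y z : E,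
    (x <= riesz_meet y z) = (x <= y) && (x <= z) ;
  riesz_joinP : forall x y z : E,
    (riesz_join x y <= z) = (x <= z) && (y <= z)
}.

#[short(type="rieszType")]
HB.structure Definition Riesz (R : realType) :=
  { E of GRing.Lmodule R E & Num.POrderedZmodule E
       & POrderedLmodule_isRiesz R E }.

(* Beware that [+] and [-] bind tighter: [x `|` y - z] is [x `|` (y - z)]. *)
Notation "x `&` y" := (riesz_meet x y) : ring_scope.
Notation "x `|` y" := (riesz_join x y) : ring_scope.

Definition riesz_neg (R : realType) (E : rieszType R) (x : E) : E := (- x) `|` 0.

Definition riesz_abs (R : realType) (E : rieszType R) (x : E) : E := x `|` (- x).

Definition riesz_archimedean (R : realType) (E : rieszType R) : Prop :=
  forall x y : E, 0 <= x -> 0 <= y -> (forall n : nat, x *+ n <= y) -> x = 0.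

(* [trunc] is total, but only its values on the positive cone are constrained,
   and only those are ever used. *)
HB.mixin Record Riesz_isTruncated (R : realType) E of Riesz R E := {
  trunc : E -> E ;
  trunc_ge0 : forall a : E, 0 <= a -> 0 <= trunc a ;
  truncP : forall a b : E, 0 <= a -> 0 <= b ->
    a `&` trunc b <= trunc a <= a ;
  trunc_eq0 : forall a : E, 0 <= a -> trunc a = 0 -> a = 0
}.

#[short(type="truncRieszType")]
HB.structure Definition TruncRiesz (R : realType) :=
  { E of Riesz R E & Riesz_isTruncated R E }.

Definition unital (R : realType) (E : truncRieszType R) : Prop :=
  exists2 u : E, 0 <= u & forall x : E, 0 <= x -> trunc x = x `&` u.

Definition trunc_fixed (R : realType) (E : truncRieszType R) (x : E) : bool :=
  trunc (riesz_abs x) == riesz_abs x.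

Definition unitization (R : realType) (E : truncRieszType R) : Type :=
  (E * R^o)%type.

HB.instance Definition _ (R : realType) (E : truncRieszType R) :=
  GRing.Lmodule.on (unitization E).

Definition unitization_cone (R : realType) (E : truncRieszType R)
    (z : unitization E) : bool :=
  let x : E := z.1 in let l : R := z.2 in
  ((l == 0) && (0 <= x)) ||
  ((0 < l) && trunc_fixed (l^-1 *: riesz_neg x)).

Section RieszTheory.
Variables (R : realType) (E : rieszType R).
Implicit Types (x y z t : E) (a b : R).

Lemma riesz_subr_ge0 x y : (0 <= y - x) = (x <= y).
Proof.
apply/idP/idP => [/(riesz_leD2r x _ _)|/(riesz_leD2r (- x) _ _)].
  by rewrite add0r subrK.
by rewrite subrr.
Qed.

Lemma riesz_leD x y z t : x <= y -> z <= t -> x + z <= y + t.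
Proof.
move=> xy zt; apply: (le_trans (riesz_leD2r z _ _ xy)).
by rewrite ![y + _]addrC; exact: riesz_leD2r.
Qed.

Lemma riesz_addr_ge0 x y : 0 <= x -> 0 <= y -> 0 <= x + y.
Proof. by move=> x0 y0; rewrite -[0]addr0; exact: riesz_leD. Qed.

Lemma riesz_leBlDr x y z : (x - y <= z) = (x <= z + y).
Proof. by rewrite -(riesz_subr_ge0 (x - y)) -(riesz_subr_ge0 x) opprB addrA addrAC. Qed.

Lemma riesz_leN2 x y : (- x <= - y) = (y <= x).
Proof. by rewrite -(riesz_subr_ge0 (- x)) opprK addrC riesz_subr_ge0. Qed.

Lemma riesz_leZ2l a x y : 0 <= a -> x <= y -> a *: x <= a *: y.
Proof.
by move=> a0 xy; rewrite -riesz_subr_ge0 -scalerBr riesz_scale_ge0 ?riesz_subr_ge0.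
Qed.

Lemma riesz_leIl x y : x `&` y <= x.
Proof. by have := lexx (x `&` y); rewrite riesz_meetP => /andP[]. Qed.

Lemma riesz_leIr x y : x `&` y <= y.
Proof. by have := lexx (x `&` y); rewrite riesz_meetP => /andP[]. Qed.

Lemma riesz_leUl x y : x <= x `|` y.
Proof. by have := lexx (x `|` y); rewrite riesz_joinP => /andP[]. Qed.

Lemma riesz_leUr x y : y <= x `|` y.
Proof. by have := lexx (x `|` y); rewrite riesz_joinP => /andP[]. Qed.

Lemma riesz_meet_l x y : x <= y -> x `&` y = x.
Proof. by move=> xy; apply: le_anti; rewrite riesz_leIl riesz_meetP lexx. Qed.

Lemma riesz_join_l x y : y <= x -> x `|` y = x.
Proof. by move=> xy; apply: le_anti; rewrite riesz_leUl riesz_joinP lexx xy. Qed.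

Lemma riesz_neg_ge0 x : 0 <= riesz_neg x.
Proof. exact: riesz_leUr. Qed.

Lemma riesz_abs_ge0E x : 0 <= x -> riesz_abs x = x.
Proof.
move=> x0; apply/riesz_join_l/(le_trans _ x0).
by rewrite -riesz_leN2 opprK oppr0.
Qed.

End RieszTheory.

Section UnitizationTheory.
Variables (R : realType) (E : truncRieszType R).
Implicit Types (x y f g : E) (a b l m : R) (z w : unitization E).

Let F f := (0 <= f) && (trunc f == f).

Let F_ge0 f : F f -> 0 <= f. Proof. by case/andP. Qed.
Let F_id f : F f -> trunc f = f. Proof. by case/andP => _ /eqP. Qed.

Let F_trunc x : 0 <= x -> F (trunc x).
Proof.
move=> x0; have t0 := trunc_ge0 x x0; rewrite /F t0 /= eq_le.
have /andP[_ ->] := truncP _ _ t0 t0 => /=.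
by have /andP[+ _] := truncP _ _ t0 x0; rewrite riesz_meet_l.
Qed.

Let F_le f g : 0 <= f -> f <= g -> F g -> F f.
Proof.
move=> f0 fg Fg; rewrite /F f0 /= eq_le.
have /andP[+ ->] := truncP _ _ f0 (F_ge0 Fg).
by rewrite (F_id Fg) (riesz_meet_l fg) => ->.
Qed.

Let F_join f g : F f -> F g -> F (f `|` g).
Proof.
move=> Ff Fg; have h0 : 0 <= f `|` g by rewrite (le_trans (F_ge0 Ff)) ?riesz_leUl.
rewrite /F h0 /= eq_le riesz_joinP.
have /andP[+ ->] := truncP _ _ h0 (F_ge0 Ff).
have /andP[+ _] := truncP _ _ h0 (F_ge0 Fg).
rewrite (F_id Ff) (F_id Fg) => hg hf.
rewrite andTb; apply/andP; split.
  by apply: le_trans hf; rewrite riesz_meetP lexx riesz_leUl.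
by apply: le_trans hg; rewrite riesz_meetP lexx riesz_leUr.
Qed.

Let F0 : F 0.
Proof.
rewrite /F lexx /= eq_le trunc_ge0 // andbT.
by have /andP[] := truncP (0 : E) 0 (lexx _) (lexx _).
Qed.

Let trunc_fixedE f : 0 <= f -> trunc_fixed f = F f.
Proof. by move=> f0; rewrite /trunc_fixed /F riesz_abs_ge0E ?f0. Qed.

Lemma unitization_coneP z :
  reflect (0 <= (z.2 : R) /\
           exists2 f : E, (0 <= f) && (trunc f == f) & 0 <= z.1 + (z.2 : R) *: f)
          (unitization_cone z).
Proof.
case: z => x l /=; apply: (iffP idP); rewrite /unitization_cone /=.
  case/orP => /andP[].
    move=> /eqP-> x0; split=> //; exists 0; first exact: F0.
    by rewrite scaler0 addr0.
  move=> l0 fx; split; first exact: ltW.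
  exists (l^-1 *: riesz_neg x).
    by rewrite -[_ && _]/(F _) -trunc_fixedE ?riesz_scale_ge0 ?riesz_neg_ge0 ?invr_ge0 ?ltW.
  rewrite scalerA divff ?gt_eqF // scale1r addrC -[X in _ + X]opprK.
  by rewrite riesz_subr_ge0 riesz_leUl.
case=> l0 [f Ff xf]; move: l0; rewrite le_eqVlt => /orP[/eqP l0|l0].
  by move: xf; rewrite -l0 eqxx scale0r addr0 => ->.
rewrite l0 /= orbC trunc_fixedE; last first.
  by rewrite riesz_scale_ge0 ?riesz_neg_ge0 ?invr_ge0 ?ltW.
apply/orP; left; apply: (F_le _ _ Ff).
  by rewrite riesz_scale_ge0 ?riesz_neg_ge0 ?invr_ge0 ?ltW.
have -> : f = l^-1 *: (l *: f) by rewrite scalerA mulVf ?gt_eqF // scale1r.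
apply: riesz_leZ2l; first by rewrite invr_ge0 ltW.
rewrite riesz_joinP; apply/andP; split.
  by rewrite -(riesz_subr_ge0 (- x)) opprK addrC.
by rewrite riesz_scale_ge0 ?(F_ge0 Ff) ?ltW.
Qed.

Let coneD z w : unitization_cone z -> unitization_cone w -> unitization_cone (z + w).
Proof.
move=> /unitization_coneP[z0 [f Ff zf]] /unitization_coneP[w0 [g Fg wg]].
apply/unitization_coneP; split; first exact: addr_ge0.
exists (f `|` g); first exact: F_join.
rewrite /= scalerDl addrACA; apply: riesz_addr_ge0.
  by apply: (le_trans zf); apply: riesz_leD => //; apply: riesz_leZ2l; rewrite ?riesz_leUl.
by apply: (le_trans wg); apply: riesz_leD => //; apply: riesz_leZ2l; rewrite ?riesz_leUr.
Qed.

Let coneZ a z : 0 <= a -> unitization_cone z -> unitization_cone (a *: z).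
Proof.
move=> a0 /unitization_coneP[z0 [f Ff zf]]; apply/unitization_coneP; split.
  exact: mulr_ge0.
by exists f => //=; rewrite -scalerA -scalerDr riesz_scale_ge0.
Qed.

Let cone_anti z : unitization_cone z -> unitization_cone (- z) -> z = 0.
Proof.
case: z => x l /unitization_coneP[/= l0 [f _ +]] /unitization_coneP[/= l1 [g _]].
have -> : l = 0 by apply/eqP; rewrite eq_le l0 -oppr_ge0 l1.
rewrite oppr0 !scale0r !addr0 => x0 x1.
by congr pair; apply/eqP; rewrite eq_le x0 -(riesz_subr_ge0 x) sub0r x1.
Qed.

Definition unitization_le z w := unitization_cone (w - z).

Let ule_refl : reflexive unitization_le.
Proof.
by move=> z; rewrite /unitization_le subrr /unitization_cone /= eqxx lexx.
Qed.

Let ule_anti : antisymmetric unitization_le.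
Proof.
move=> z w /andP[zw wz]; apply/esym/eqP; rewrite -subr_eq0; apply/eqP.
by apply: cone_anti => //; rewrite opprB.
Qed.

Let ule_trans : transitive unitization_le.
Proof.
move=> w z v zw wv; rewrite /unitization_le -[v](subrK w) -addrA.
exact: coneD.
Qed.

HB.instance Definition _ := Choice.on (unitization E).
HB.instance Definition _ := @Order.Le_isPOrder.Build ring_display (unitization E)
  unitization_le ule_refl ule_anti ule_trans.

(* z^+ for z = x - m with 0 <= m: x^+ - m (trunc (x^+ / m)), i.e. x^+ if m = 0 *)
Let pos_low z : unitization E :=
  let m : R := - (z.2 : R) in
  ((z.1 `|` 0) - m *: trunc (m^-1 *: (z.1 `|` 0)), 0).

Let is_pos z p := [/\ unitization_cone p, unitization_cone (p - z) &
  forall w, unitization_cone w -> unitization_cone (w - z) ->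
            unitization_cone (w - p)].

Let pos_lowP z : (z.2 : R) <= 0 -> is_pos z (pos_low z).
Proof.
case: z => x l /= l0; rewrite /pos_low /=.
have [m m0 ->] : exists2 m : R, 0 <= m & l = - m.
  by exists (- l); rewrite ?oppr_ge0 ?opprK.
rewrite opprK; set q := x `|` 0.
have q0 : 0 <= q by exact: riesz_leUr.
have p0 : 0 <= m^-1 *: q by rewrite riesz_scale_ge0 ?invr_ge0.
set t := trunc _; have Ft : F t by exact: F_trunc.
split.
- apply/unitization_coneP => /=; split=> //; exists 0; first exact: F0.
  rewrite scaler0 addr0 riesz_subr_ge0.
  have [->|mn0] := eqVneq m 0; first by rewrite scale0r.
  rewrite -[X in _ <= X]scale1r -(divff mn0) -scalerA.
  by apply: riesz_leZ2l => //; have /andP[] := truncP _ _ p0 p0.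
- apply/unitization_coneP => /=; rewrite sub0r opprK; split=> //; exists t => //.
  by rewrite addrAC subrK riesz_subr_ge0 riesz_leUl.
- case=> y r /unitization_coneP[/= r0 [f Ff yf]].
  move=> /unitization_coneP[/=]; rewrite opprK => rm0 [g Fg yg].
  apply/unitization_coneP => /=; rewrite subr0; split=> //.
  pose h := f `|` g; exists h; first exact: F_join.
  have Fh : F h by exact: F_join.
  have yh : 0 <= y + r *: h.
    apply: (le_trans yf); apply: riesz_leD => //.
    by apply: riesz_leZ2l; rewrite ?riesz_leUl.
  have yxh : x <= y + r *: h + m *: h.
    rewrite -addrA -scalerDl -riesz_subr_ge0 addrAC.
    apply: (le_trans yg); apply: riesz_leD => //.
    by apply: riesz_leZ2l; rewrite ?riesz_leUr.
  have tm : q `&` (m *: h) <= m *: t.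
    have [->|mn0] := eqVneq m 0; first by rewrite !scale0r riesz_leIr.
    have /andP[+ _] := truncP _ _ p0 (F_ge0 Fh); rewrite (F_id Fh) -/t.
    move=> /(riesz_leZ2l m0); apply: le_trans.
    set s := q `&` _; rewrite -[s]scale1r -(divff mn0) -scalerA.
    apply: riesz_leZ2l => //; rewrite riesz_meetP; apply/andP; split.
      by apply: riesz_leZ2l; rewrite ?invr_ge0 ?riesz_leIl.
    rewrite -[h]scale1r -(mulVf mn0) -scalerA.
    by apply: riesz_leZ2l; rewrite ?invr_ge0 ?riesz_leIr.
  rewrite opprB addrAC addrA riesz_subr_ge0.
  apply: (@le_trans _ _ (y + r *: h + (q `&` (m *: h)))); last exact: riesz_leD.
  rewrite addrC -riesz_leBlDr riesz_meetP; apply/andP; split.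
    by rewrite riesz_leBlDr -[X in X <= _]addr0; apply: riesz_leD.
  rewrite riesz_leBlDr [X in _ <= X]addrC riesz_joinP yxh /=.
  by rewrite riesz_addr_ge0 // riesz_scale_ge0 // (F_ge0 Fh).
Qed.

(* in the second case, z^+ = z + (- z)^+ *)
Definition unitization_pos z : unitization E :=
  if (z.2 : R) <= 0 then pos_low z else z + pos_low (- z).

Let posP z : is_pos z (unitization_pos z).
Proof.
rewrite /unitization_pos; case: ifPn => [|]; first exact: pos_lowP.
rewrite -ltNge => z0; have : ((- z).2 : R) <= 0 by rewrite oppr_le0 ltW.
move=> /pos_lowP[p0 pz plub]; split.
- by move: pz; rewrite opprK addrC.
- by rewrite addrAC subrr add0r.
- move=> w w0 wz; rewrite opprD addrA; apply: plub => //.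
  by rewrite opprK subrK.
Qed.

Definition unitization_join z w := unitization_pos (z - w) + w.

Definition unitization_meet z w := - unitization_join (- z) (- w).

Let ujoinP (z w v : unitization E) :
  (unitization_join z w <= v) = (z <= v) && (w <= v).
Proof.
rewrite /unitization_join; have [p0 pz plub] := posP (z - w).
have uleE (p q : unitization E) : (p <= q) = unitization_cone (q - p) by [].
rewrite !uleE.
apply/idP/andP => [vp|[zv wv]].
  split.
    have := coneD vp pz.
    by rewrite opprB [X in _ + X]addrA addrA subrK.
  by have := coneD vp p0; rewrite opprD addrA addrAC subrK.
rewrite opprD addrA addrAC; apply: plub => //.
by rewrite opprB addrA subrK.
Qed.

Let umeetP (z w v : unitization E) :
  (z <= unitization_meet w v) = (z <= w) && (z <= v).
Proof.
have N (p q : unitization E) : (p <= q) = (- q <= - p).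
  by rewrite /Order.le /= /unitization_le opprK addrC.
by rewrite /unitization_meet N opprK ujoinP -!N.
Qed.

Let ule_leD2r (v z w : unitization E) : z <= w -> z + v <= w + v.
Proof. by rewrite /Order.le /= /unitization_le opprD addrACA subrr addr0. Qed.

Let ule_scale_ge0 a z : 0 <= a -> 0 <= z -> 0 <= a *: z.
Proof. by rewrite /Order.le /= /unitization_le !subr0; exact: coneZ. Qed.

HB.instance Definition _ := @POrderedLmodule_isRiesz.Build R (unitization E)
  ule_leD2r ule_scale_ge0 unitization_meet unitization_join umeetP ujoinP.

Lemma unitization_leE z w : (z <= w) = unitization_cone (w - z).
Proof. by []. Qed.

End UnitizationTheory.

(* Main.v *)
(* If [z *+ n <= w] for all [n], the scalar part of [z] vanishes because the
   reals are Archimedean. A truncation unit [u] bounds every fixed point, so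
   positivity of [w - z *+ n] gives [z.1 *+ n <= w.1 + w.2 *: u] in [E], with a
   right-hand side independent of [n]. *)
Require Import Defs.
From mathcomp Require Import all_boot all_order all_algebra reals.

Set Implicit Arguments.
Unset Strict Implicit.
Unset Printing Implicit Defensive.

Import Order.TTheory GRing.Theory Num.Theory.
Local Open Scope ring_scope.

(** If [a] were positive, some natural number would exceed [b / a], against the bound. The case
    [n = 0] supplies [0 <= b]. *)
Lemma mulrn_bounded_eq0 (R : archiRealFieldType) (a b : R) :
  0 <= a -> (forall n : nat, a *+ n <= b) -> a = 0.
Proof.
move=> a0 ab; apply/eqP; rewrite eq_le a0 andbT leNgt; apply/negP => a_gt0.
have b0 : 0 <= b by have := ab 0%N; rewrite mulr0n.
have := archi_boundP (divr_ge0 b0 a0).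
by rewrite ltr_pdivrMr // mulr_natl ltNge ab.
Qed.

Section Unitization.
Variables (R : realType) (E : truncRieszType R).

Lemma unitization_fstMn (z : unitization E) n : (z *+ n).1 = z.1 *+ n.
Proof. exact: (raddfMn (@fst E R^o)). Qed.

Lemma unitization_sndMn (z : unitization E) n :
  ((z *+ n).2 : R) = (z.2 : R) *+ n.
Proof. exact: (raddfMn (@snd E R^o)). Qed.

(** The difference has scalar part [0], which leaves only the [E^+] branch of the cone. *)
Lemma unitization_le_fst (z w : unitization E) :
  z.2 = w.2 -> (z <= w) = (z.1 <= w.1).
Proof.
case: z w => [x l] [y m] /= ->.
by rewrite unitization_leE /unitization_cone /= subrr eqxx ltxx orbF riesz_subr_ge0.
Qed.

(** The fixed point [f] witnessing positivity of [w - z] satisfies [f = trunc f], the meet of [f]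
    and [u]. Hence [f <= u], and [u] can replace [f]. *)
Lemma unitization_le_unit (u : E) (z w : unitization E) :
    (forall x : E, 0 <= x -> trunc x = riesz_meet x u) -> z <= w ->
  (z.2 : R) <= w.2 /\ z.1 <= w.1 + ((w.2 : R) - z.2) *: u.
Proof.
move=> truncE; rewrite unitization_leE.
case: z w => [x l] [y m] /unitization_coneP[/= lm [f /andP[f0 /eqP ft] xy]].
split; first by rewrite -subr_ge0.
have fu : f <= u by rewrite -ft truncE // riesz_leIr.
rewrite -riesz_subr_ge0 addrAC; apply: (le_trans xy).
by apply: riesz_leD => //; apply: riesz_leZ2l.
Qed.

End Unitization.

Theorem corollary3p2 (R : realType) (E : truncRieszType R) :
  unital E -> (riesz_archimedean (unitization E) <-> riesz_archimedean E).
Proof.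
case=> u _ truncE; split=> arch.
  move=> x y x0 y0 xy.
  (* Transfer along the order embedding of [E] as the elements with scalar part [0]. *)
  suff /(congr1 fst) : ((x, 0) : unitization E) = 0 by [].
  apply: (arch _ (y, 0)) => [||n]; rewrite unitization_le_fst //=.
    by rewrite unitization_fstMn.
  by rewrite unitization_sndMn /= mul0rn.
move=> z w z0 w0 zw.
have [z2 _] := unitization_le_unit truncE z0.
have [w2 w1] := unitization_le_unit truncE w0.
have z2E : (z.2 : R) = 0.
  apply: (mulrn_bounded_eq0 (b := w.2)) => // n.
  by rewrite -unitization_sndMn; have [] := unitization_le_unit truncE (zw n).
(* This needs [z2E]: in general [0 <= z] only yields [0 <= z.1 + z.2 *: u]. *)
have z1 : 0 <= z.1 by rewrite -(@unitization_le_fst _ _ 0).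
suff z1E : z.1 = 0 by case: z z1E z2E {z0 zw z2 z1} => [x l] /= -> ->.
apply: (arch _ (w.1 + (w.2 : R) *: u)) => // [|n].
  by rewrite subr0 in w1.
have [_] := unitization_le_unit truncE (zw n).
by rewrite unitization_fstMn unitization_sndMn z2E mul0rn subr0.
Qed.
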